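(* (a) Let $M$ be a smooth manifold with a family of (integrable) complex structures $J^{(\zeta)}$, $\zeta\in\mathbb{P}^1$, such that $J^{(-1/\bar\zeta)}=-J^{(\zeta)}$ for all $\zeta\in\mathbb{P}^1$. Suppose also that there is an isomorphism of complex vector bundles $\kappa: T^{(0,1)}M^{(0)}\to T^{(1,0)}M^{(0)}$ such that $$T^{(0,1)}M^{(\zeta)}=(1+\zeta\kappa)\,T^{(0,1)}M^{(0)}\qquad\text{for all }\zeta\in\mathbb{C}.$$ Define $J_1=J^{(i)}$, $J_2=J^{(-1)}$, $J_3=J^{(0)}$. Then (i) $\kappa=J_1|_{T^{(0,1)}M^{(0)}}$, and (ii) $J_1,J_2,J_3$ satisfy the unit quaternion relations $J_\alpha J_\beta=\sum_{\gamma}\epsilon_{\alpha\beta\gamma}J_\gamma-\delta_{\alpha\beta}$ for $\alpha,\beta\in\{1,2,3\}$. (b) Let $M$ be a smooth manifold, and for $\zeta\in\mathbb{C}^\times$ let $$\varpi(\zeta)=-\frac{i}{2\zeta}\omega_++\omega_3-\frac{i}{2}\zeta\,\omega_-$$ be a family of holomorphic symplectic forms on the real manifold $M$, where $\omega_+$ is also a holomorphic symplectic form on the real manifold $M$, $\omega_-=\overline{\omega_+}$ and $\omega_3=\overline{\omega_3}$. Let $J^{(\zeta)}$ be the complex structure determined by $\varpi(\zeta)$ for $\zeta\in\mathbb{C}^\times$, by $\omega_+$ for $\zeta=0$, and by $\omega_-$ for $\zeta=\infty$; put $J_1=J^{(i)}$, $J_2=J^{(-1)}$, $J_3=J^{(0)}$,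 and define real 2-forms $\omega_1,\omega_2$ by $\omega_\pm=\omega_1\pm i\omega_2$. Then $M$ is a pseudo-hyper-Kähler manifold with pseudo-Kähler forms $(\omega_1,\omega_2,\omega_3)$ corresponding to the complex structures $(J_1,J_2,J_3)$; that is, there is a pseudo-Riemannian metric $g$ on $M$ such that $(M,g,(\omega_\alpha)_{\alpha=1}^3,(J_\alpha)_{\alpha=1}^3)$ is a pseudo-hyper-Kähler manifold. (c) If the family $\varpi(\zeta)$ in (b) arises from a pseudo-hyper-Kähler structure $(g^\circ,(\omega_\alpha)_{\alpha=1}^3,(J^\circ_\alpha)_{\alpha=1}^3)$ on $M$, i.e. $\varpi(\zeta)=-\frac{i}{2\zeta}(\omega_1+i\omega_2)+\omega_3-\frac{i}{2}\zeta(\omega_1-i\omega_2)$ where $\omega_1,\omega_2,\omega_3$ are its pseudo-Kähler forms, then the pseudo-hyper-Kähler structure produced in (b) agrees with the original one: $g=g^\circ$ and $J_\alpha=J^\circ_\alpha$ for $\alpha=1,2,3$.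
   Context: For a complex structure $J^{(\zeta)}$ on $M$, $M^{(\zeta)}$ denotes the complex manifold $(M,J^{(\zeta)})$; $T_{\mathbb{C}}M=TM\otimes\mathbb{C}$; $T^{(1,0)}M^{(\zeta)}$ and $T^{(0,1)}M^{(\zeta)}$ are the $+i$ and $-i$ eigenbundles of $J^{(\zeta)}$ in $T_{\mathbb{C}}M$. The antipodal map on $\mathbb{P}^1=\mathbb{C}\cup\{\infty\}$ is $\zeta\mapsto-1/\bar\zeta$ (exchanging $0$ and $\infty$). $\epsilon_{\alpha\beta\gamma}$ is the totally antisymmetric symbol with $\epsilon_{123}=1$, and $\delta_{\alpha\beta}$ is the Kronecker delta. Holomorphic symplectic form on a real manifold $M$: a closed complex-valued 2-form $\Omega$, regarded as a map $\Omega:T_{\mathbb{C}}M\to T^*_{\mathbb{C}}M$, such that $T_{\mathbb{C}}M=\ker\Omega\oplus\ker\bar\Omega$. Such an $\Omega$ determines a unique complex structure on $M$ for which $\Omega$ is a holomorphic symplectic form in the usual sense; it is given by $T^{(0,1)}M=\ker\Omega$, $T^{(1,0)}M=\ker\bar\Omega$. Pseudo-hyper-Kähler manifold: a manifold $M$ with a pseudo-Riemannian metric $g$ (nondegenerate symmetric 2-tensor, not necessarily positive definite), a triplet of (real) symplectic forms $(\omega_1,\omega_2,\omega_3)$ and a triplet of complex structures $(J_1,J_2,J_3)$ satisfying $J_\alpha J_\beta=\sum_\gamma\epsilon_{\alpha\beta\gamma}J_\gamma-\delta_{\alpha\beta}$, such that for each $\alpha=1,2,3$ the pseudo-Kähler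 compatibility condition $\omega_\alpha(v_1,v_2)=g(J_\alpha v_1,v_2)$ (equivalently $g(v_1,v_2)=\omega_\alpha(v_1,J_\alpha v_2)$) holds. It carries the associated $\mathbb{P}^1$-family of symplectic and complex structures $\omega^{(\zeta)}=\sum_\alpha c^{(\zeta)}_\alpha\omega_\alpha$, $J^{(\zeta)}=\sum_\alpha c_\alpha^{(\zeta)}J_\alpha$, where $c^{(\zeta)}=\frac{1}{1+|\zeta|^2}(2\,\mathrm{Im}\,\zeta,\,-2\,\mathrm{Re}\,\zeta,\,1-|\zeta|^2)$. *)

(* Defs.v *)
From HB Require Import structures.
From mathcomp Require Import all_boot all_order all_algebra.
From mathcomp Require Import all_classical all_reals all_analysis.
From mathcomp Require Import complex.

Set Implicit Arguments.
Unset Strict Implicit.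
Unset Printing Implicit Defensive.

Import Order.TTheory GRing.Theory Num.Theory.
Import numFieldNormedType.Exports.

Local Open Scope classical_set_scope.
Local Open Scope ring_scope.

(* f is of class C^k on the open set U.  On a finite-dimensional V, the
   derivative of f is C^k iff all the directional derivatives of f are. *)
Fixpoint class_C (R : realType) (V W : normedModType R) (k : nat)
    (U : set V) (f : V -> W) : Prop :=
  match k with
  | 0 => forall y, U y -> {for y, continuous f}
  | k'.+1 => (forall y, U y -> differentiable f y) /\
             (forall v, class_C k' U (fun y => 'D_v f y))
  end.

Definition smooth_on (R : realType) (V W : normedModType R)
    (U : set V) (f : V -> W) : Prop := forall k, class_C k U f.

(* chart_map and chart_inv are total functions, meaningful on chart_dom and
   chart_cod only. *)
Record chart (R : realType) (n : nat) (T : topologicalType) := Chart {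
  chart_dom : set T;
  chart_cod : set 'rV[R]_n;
  chart_map : T -> 'rV[R]_n;
  chart_inv : 'rV[R]_n -> T;
  chart_dom_open : open chart_dom;
  chart_cod_open : open chart_cod;
  chart_map_cod : forall x, chart_dom x -> chart_cod (chart_map x);
  chart_inv_dom : forall y, chart_cod y -> chart_dom (chart_inv y);
  chart_mapK : forall x, chart_dom x -> chart_inv (chart_map x) = x;
  chart_invK : forall y, chart_cod y -> chart_map (chart_inv y) = y;
  chart_map_cont : forall x, chart_dom x -> {for x, continuous chart_map};
  chart_inv_cont : forall y, chart_cod y -> {for y, continuous chart_inv} }.

(* Smooth manifolds of dimension n.  As chart_at selects a chart around every
   point, T_x M can be identified with R^n through the chart chart_at x: below,
   tangent vectors at x are the column vectors of their components in
   chart_at x, and tensor fields are plain functions on M. *)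
Record manifold (R : realType) (n : nat) := Manifold {
  carrier :> topologicalType;
  carrier_hausdorff : hausdorff_space carrier;
  carrier_second_countable : @second_countable carrier;
  atlas : set (chart R n carrier);
  chart_at : carrier -> chart R n carrier;
  chart_at_atlas : forall x, atlas (chart_at x);
  chart_at_dom : forall x, chart_dom (chart_at x) x;
  transition_smooth : forall c d, atlas c -> atlas d ->
    smooth_on [set y | chart_cod c y /\ chart_dom d (chart_inv c y)]
              (fun y => chart_map d (chart_inv c y)) }.

Section Fields.
Context (R : realType) (n : nat) (M : manifold R n).

Local Notation C := R[i].

(* Sections of End(TM) or of (T^*M)^{\otimes 2}, depending on the context: an
   endomorphism A maps v to A *m v, a form B maps (v, w) to v^T *m B *m w. *)
Definition tensor := M -> 'M[R]_n.
Definition ctensor := M -> 'M[C]_n.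

Definition bil (K : fieldType) (B : 'M[K]_n) (v w : 'cV[K]_n) : K :=
  (v^T *m B *m w) 0 0.

(* The matrix taking the components of a tangent vector at x := chart_inv c y
   in the chart c to its components in chart_at x.  The transpose is there because
   the Jacobian 'J acts on row vectors. *)
Definition frame (c : chart R n M) (y : 'rV[R]_n) : 'M[R]_n :=
  ('J (fun z => chart_map (chart_at (chart_inv c y)) (chart_inv c z)) y)^T.

(* Components, in the chart c, of a field of endomorphisms (entry (k, i) is
   J^k_i) and of a field of bilinear forms. *)
Definition endo_in (c : chart R n M) (J : tensor) (y : 'rV[R]_n) : 'M[R]_n :=
  invmx (frame c y) *m J (chart_inv c y) *m frame c y.

Definition form_in (c : chart R n M) (B : tensor) (y : 'rV[R]_n) : 'M[R]_n :=
  (frame c y)^T *m B (chart_inv c y) *m frame c y.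

Definition smooth_endo (J : tensor) : Prop :=
  forall c, atlas c -> smooth_on (chart_cod c) (endo_in c J).

Definition smooth_form (B : tensor) : Prop :=
  forall c, atlas c -> smooth_on (chart_cod c) (form_in c B).

Definition partial (F : 'rV[R]_n -> 'M[R]_n) (l i j : 'I_n)
  (y : 'rV[R]_n) : R := 'D_(delta_mx 0 l) (fun z => F z i j) y.

Definition closed_form (B : tensor) : Prop :=
  forall c y, atlas c -> chart_cod c y -> forall i j k,
    partial (form_in c B) i j k y + partial (form_in c B) j k i y
    + partial (form_in c B) k i j y = 0.

Definition two_form (B : tensor) : Prop :=
  smooth_form B /\ forall x, (B x)^T = - B x.

Definition symplectic_form (w : tensor) : Prop :=
  [/\ two_form w, closed_form w & forall x, w x \in unitmx].

Definition pseudo_metric (g : tensor) : Prop :=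
  [/\ smooth_form g, forall x, (g x)^T = g x & forall x, g x \in unitmx].

(* Component N^k_{ij} of the Nijenhuis tensor of J in the chart c. *)
Definition nijenhuis_in (c : chart R n M) (J : tensor) (k i j : 'I_n)
    (y : 'rV[R]_n) : R :=
  let F := endo_in c J in
  \sum_l (F y l i * partial F l k j y - F y l j * partial F l k i y
          - F y k l * (partial F i l j y - partial F j l i y)).

(* Integrability is the vanishing of the Nijenhuis tensor. *)
Definition complex_structure (J : tensor) : Prop :=
  [/\ smooth_endo J,
      forall x, J x *m J x = - 1%:M &
      forall c y, atlas c -> chart_cod c y ->
        forall k i j, nijenhuis_in c J k i j y = 0].

Definition to_cx (B : tensor) : ctensor := fun x => map_mx (real_complex R) (B x).
Definition re_cx (B : ctensor) : tensor := fun x => map_mx (@complex.Re R) (B x).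
Definition im_cx (B : ctensor) : tensor := fun x => map_mx (@complex.Im R) (B x).
Definition conj_cx (B : ctensor) : ctensor :=
  fun x => map_mx (@conjc R) (B x).

Definition T10 (J : tensor) (x : M) : set 'cV[C]_n :=
  [set v | to_cx J x *m v = 'i%C *: v].
Definition T01 (J : tensor) (x : M) : set 'cV[C]_n :=
  [set v | to_cx J x *m v = - 'i%C *: v].

(* Kernel of v |-> Omega(v, _). *)
Definition kerf (Omega : ctensor) (x : M) : set 'cV[C]_n :=
  [set v | forall w, bil (Omega x) v w = 0].

Definition direct_sum (E F : set 'cV[C]_n) : Prop :=
  (forall v, exists2 u, E u & F (v - u)) /\ (E `&` F = [set 0]).

Definition hol_symplectic (Omega : ctensor) : Prop :=
  [/\ two_form (re_cx Omega) /\ two_form (im_cx Omega),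
      closed_form (re_cx Omega) /\ closed_form (im_cx Omega) &
      forall x, direct_sum (kerf Omega x) (kerf (conj_cx Omega) x)].

(* The complex structure determined by Omega. *)
Definition cs_of (Omega : ctensor) : tensor :=
  xget (fun=> 0) [set J | complex_structure J /\
    forall x, T01 J x = kerf Omega x /\ T10 J x = kerf (conj_cx Omega) x].

(* An isomorphism of complex vector bundles from E to F, both subbundles of the
   complexified tangent bundle, is given by a smooth section K of the bundle of
   endomorphisms of the latter; only the restriction of K to E matters.  Such
   an extension of the isomorphism always exists when E has a smooth
   complement. *)
Definition bundle_iso (E F : M -> set 'cV[C]_n) (K : ctensor) : Prop :=
  [/\ smooth_endo (re_cx K), smooth_endo (im_cx K) &
      forall x, set_bij (E x) (F x) (fun v => K x *m v)].

(* epsilon_{abc}, with indices shifted to {0, 1, 2}. *)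
Definition eps (a b c : 'I_3) : R :=
  (b%:R - a%:R) * (c%:R - a%:R) * (c%:R - b%:R) / 2.

Definition quaternionic (J : 'I_3 -> tensor) : Prop :=
  forall (a b : 'I_3) x,
    J a x *m J b x = \sum_(c < 3) eps a b c *: J c x - (a == b)%:R%:M.

Definition pseudo_hyper_kahler (g : tensor) (w J : 'I_3 -> tensor) : Prop :=
  [/\ pseudo_metric g,
      forall a, symplectic_form (w a),
      forall a, complex_structure (J a),
      quaternionic J &
      forall a x v1 v2, bil (w a x) v1 v2 = bil (g x) (J a x *m v1) v2].

Definition triple (T : Type) (a b c : T) : 'I_3 -> T := tnth [tuple a; b; c].

(* The complex projective line; None is the point at infinity. *)
Definition P1 := option C.

Definition antipode (z : P1) : P1 :=
  match z with
  | None => Some 0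
  | Some z => if z == 0 then None else Some (- (conjc z)^-1)
  end.

(* J_1 = J^(i), J_2 = J^(-1), J_3 = J^(0). *)
Definition J123 (J : P1 -> tensor) : 'I_3 -> tensor :=
  triple (J (Some 'i%C)) (J (Some (-1))) (J (Some 0)).

Definition varpi (op o3 om : ctensor) (z : C) : ctensor := fun x =>
  - ('i%C / (2 * z)) *: op x + o3 x - ('i%C / 2 * z) *: om x.

Definition varpi_cs (op o3 om : ctensor) (z : P1) : tensor :=
  match z with
  | None => cs_of om
  | Some z => if z == 0 then cs_of op else cs_of (varpi op o3 om z)
  end.

Definition omega_p (w1 w2 : tensor) : ctensor :=
  fun x => to_cx w1 x + 'i%C *: to_cx w2 x.
Definition omega_m (w1 w2 : tensor) : ctensor :=
  fun x => to_cx w1 x - 'i%C *: to_cx w2 x.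

End Fields.

(* Main.v *)
(* Everything is read off the real and imaginary parts a, b of a holomorphic
   symplectic form a + ib: the form a is nondegenerate, and J is the complex
   structure determined by a + ib iff J^T a = - b, i.e. a(Jv, w) = - b(v, w).
   Thus J = - (b a^-1)^T is smooth, and integrability becomes the real identity
   expressing a(N_J(v, w), z) through da = 0 and db = 0.  For (b), the forms at
   zeta = 0, i, -1 are w1 + i w2, w3 - i w2, w3 + i w1, which gives
   J3^T w1 = - w2, J1^T w3 = w2, J2^T w3 = - w1; these relations force
   J1 J2 = J3 and make g = - J3^T w3 the common metric.  In (a), antipodality
   gives both J(zeta)(v + zeta K v) = - i (v + zeta K v) and
   J(zeta)(v - zeta K v) = i (v - zeta K v) at zeta = i, -1, so that J1 v = K v
   and J2 v = i K v on T01. *)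
Require Import Defs.
From HB Require Import structures.
From mathcomp Require Import all_boot all_order all_algebra.
From mathcomp Require Import all_classical all_reals all_analysis.
From mathcomp Require Import complex.
From mathcomp Require Import ring lra.
Import Order.TTheory GRing.Theory Num.Theory.
Import numFieldNormedType.Exports.

Local Open Scope classical_set_scope.
Local Open Scope ring_scope.

Set Implicit Arguments.
Unset Strict Implicit.
Unset Printing Implicit Defensive.

(** * Calculus of C^k maps on open sets, up to matrix products and inverses *)

(** The first-order expansion of [f] at [x] only involves values near [x], so it is also one of [g];
    uniqueness then gives ['d g x = 'd f x]. *)
Lemma near_eq_differentiable (R : realType) (V W : normedModType R)
    (f g : V -> W) (x : V) :
  (\forall y \near x, f y = g y) -> differentiable f x -> differentiable g x.
Proof.
move=> fg df.
have [dc df0] := (diff_locallyP _ _).1 df.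
have dg0 : g \o shift x = cst (g x) + 'd f x +o_ 0 id.
  apply/eqaddoP => e e0.
  move/eqaddoP : df0 => /(_ e e0) df0.
  have fg0 : \forall h \near (0 : V), f (h + x) = g (h + x).
    by move: fg; rewrite (near_shift 0) /= subr0.
  near=> h.
  rewrite -(nbhs_singleton fg) !fctE /= -(near fg0 h) //.
  by near: h.
have dgE : 'd g x = 'd f x :> (V -> W) by apply: diff_unique.
by apply/diff_locallyP; rewrite dgE.
Unshelve. all: by end_near. Qed.

Section ClassC.
Context {R : realType} {V : normedModType R}.
Implicit Types (W : normedModType R) (U : set V).

(** On an open set, equality of maps is equality near each point, so it passes to directional
    derivatives. This allows a derivative to be replaced by a formula valid on [U] only. *)
Lemma class_C_near W k U (f g : V -> W) : open U ->
  (forall y, U y -> f y = g y) -> class_C k U f -> class_C k U g.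
Proof.
move=> oU; elim: k f g => [|k IH] f g fg /=.
  move=> fc y Uy; move: (fc y Uy); rewrite /prop_for /continuous_at -(fg y Uy).
  apply: cvg_trans; apply: near_eq_cvg.
  by apply: filterS (open_nbhs_nbhs (conj oU Uy)) => z /fg.
have nfg y : U y -> \forall z \near y, f z = g z.
  by move=> Uy; apply: filterS (open_nbhs_nbhs (conj oU Uy)) => z /fg.
case=> df Df; split=> [y Uy|v].
  exact: near_eq_differentiable (nfg _ Uy) (df _ Uy).
by apply: IH (Df v) => y /nfg /near_eq_derive.
Qed.

Lemma class_CS W k U (f : V -> W) : class_C k.+1 U f -> class_C k U f.
Proof.
elim: k f => [|k IH] f [df Df].
  by move=> y /df /differentiable_continuous.
by split=> // v; apply: IH.
Qed.

Lemma class_C_cst W k U (a : W) : open U -> class_C k U (fun=> a).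
Proof.
move=> oU; elim: k a => [|k IH] a /=; first by move=> y _; apply: cst_continuous.
split=> [y _|v]; first exact: differentiable_cst.
by apply: class_C_near (IH 0) => // y _; rewrite derive_cst.
Qed.

Lemma class_C_lin W W' k U (f : V -> W) (L : {linear W -> W'}) : open U ->
  continuous L -> class_C k U f -> class_C k U (fun y => L (f y)).
Proof.
move=> oU cL; elim: k f => [|k IH] f /=.
  by move=> cf y Uy; apply: continuous_comp; [exact: cf|exact: cL].
have dL z : differentiable L z by apply: linear_differentiable.
case=> df Df; split=> [y Uy|v].
  by apply: differentiable_comp; [exact: df|exact: dL].
apply: class_C_near (IH _ (Df v)) => // y Uy.
rewrite (deriveE _ (differentiable_comp (df _ Uy) (dL _))).
by rewrite diff_comp ?diff_lin //= ?deriveE //; exact: df.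
Qed.

Lemma class_CD W k U (f g : V -> W) : open U ->
  class_C k U f -> class_C k U g -> class_C k U (fun y => f y + g y).
Proof.
move=> oU; elim: k f g => [|k IH] f g /=.
  by move=> cf cg y Uy; apply: cvgD; [exact: cf|exact: cg].
case=> df Df [dg Dg]; split=> [y Uy|v].
  by apply: differentiableD; [exact: df|exact: dg].
apply: class_C_near (IH _ _ (Df v) (Dg v)) => // y Uy.
by rewrite deriveD //; apply: diff_derivable; [exact: df|exact: dg].
Qed.

Lemma class_C_sum W k U (I : Type) (r : seq I) (F : I -> V -> W) : open U ->
  (forall i, class_C k U (F i)) -> class_C k U (fun y => \sum_(i <- r) F i y).
Proof.
move=> oU HF; elim: r => [|i r IH].
  by under eq_fun do rewrite big_nil; apply: class_C_cst.
by under eq_fun do rewrite big_cons; apply: class_CD.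
Qed.

(** Leibniz's rule multiplies derivatives, of class C^k, by the factors themselves; [class_CS]
    lowers the latter to C^k so that the induction hypothesis applies. *)
Lemma class_CM k U (f g : V -> R) : open U ->
  class_C k U f -> class_C k U g -> class_C k U (fun y => f y * g y).
Proof.
move=> oU; elim: k f g => [|k IH] f g.
  by move=> /= cf cg y Uy; apply: cvgM; [exact: cf|exact: cg].
move=> Cf Cg; have := class_CS Cf; have := class_CS Cg.
case: Cf => df Df; case: Cg => dg Dg Cg Cf; split=> [y Uy|v].
  by apply: differentiableM; [exact: df|exact: dg].
have D := class_CD oU (IH _ _ Cf (Dg v)) (IH _ _ Cg (Df v)).
apply: (class_C_near oU _ D) => y Uy.
by rewrite deriveM //; apply: diff_derivable; [exact: df|exact: dg].
Qed.

Lemma class_CN k U (f : V -> R) : open U ->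
  class_C k U f -> class_C k U (fun y => - f y).
Proof.
move=> oU Cf; have C1 : class_C k U (fun=> - 1 : R) by exact: class_C_cst.
apply: (class_C_near oU _ (class_CM oU C1 Cf)) => y _.
by rewrite mulN1r.
Qed.

Lemma class_C_prod k U (I : Type) (r : seq I) (F : I -> V -> R) : open U ->
  (forall i, class_C k U (F i)) -> class_C k U (fun y => \prod_(i <- r) F i y).
Proof.
move=> oU HF; elim: r => [|i r IH].
  by under eq_fun do rewrite big_nil; apply: class_C_cst.
by under eq_fun do rewrite big_cons; apply: class_CM.
Qed.

Lemma class_CV k U (f : V -> R) : open U -> (forall y, U y -> f y != 0) ->
  class_C k U f -> class_C k U (fun y => (f y)^-1).
Proof.
move=> oU f0; elim: k => [|k IH].
  by move=> /= cf y Uy; apply: cvgV; [exact: f0|exact: cf].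
move=> Cf; have CV := IH (class_CS Cf); case: Cf => df Df; split=> [y Uy|v].
  by apply: differentiableV; [exact: df|exact: f0].
have D := class_CN oU (class_CM oU (class_CM oU CV CV) (Df v)).
apply: (class_C_near oU _ D) => y Uy.
rewrite deriveV ?f0 //; last by apply: diff_derivable; exact: df.
by rewrite -mulNr -expr2 exprVn.
Qed.

(** Entries are continuous linear functions of a matrix; conversely [F] is the sum of its entries
    times the constant matrices [delta_mx i j]. *)
Lemma class_C_mx m n k U (F : V -> 'M[R]_(m, n)) : open U ->
  class_C k U F <-> forall i j, class_C k U (fun y => F y i j).
Proof.
move=> oU; split=> [CF i j|CF].
  have @L : {linear 'M[R]_(m, n) -> R}.
    by exists (fun N : 'M[R]_(_, _) => N i j); do 2![eexists]; do ?[constructor];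
       rewrite ?mxE// => ? *; rewrite ?mxE//; move=> ?; rewrite !mxE.
  by apply: (class_C_lin (L := L)) => //; exact: coord_continuous.
have CE i j : class_C k U (fun y => F y i j *: (delta_mx i j : 'M[R]_(m, n))).
  have lL : linear ( *:%R ^~ (delta_mx i j : 'M[R]_(m, n)) : R -> 'M[R]_(m, n)).
    by move=> u y z; rewrite scalerDl scalerA.
  pose LM := GRing.isLinear.Build _ _ _ _ _ lL.
  pose L : {linear R -> 'M[R]_(m, n)} := HB.pack ( *:%R ^~ (delta_mx i j)) LM.
  by apply: (class_C_lin (L := L)) => //; exact: scalel_continuous.
have := class_C_sum (index_enum 'I_m) oU
  (fun i => class_C_sum (index_enum 'I_n) oU (CE i)).
by apply: class_C_near => // y _; rewrite -matrix_sum_delta.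
Qed.

Lemma class_C_det n k U (F : V -> 'M[R]_n) : open U ->
  (forall i j, class_C k U (fun y => F y i j)) ->
  class_C k U (fun y => \det (F y)).
Proof.
move=> oU CF; apply: class_C_sum => // s; apply: class_CM => //.
  exact: class_C_cst.
exact: class_C_prod.
Qed.

Lemma class_C_mulmx m n p k U (F : V -> 'M[R]_(m, n)) (G : V -> 'M[R]_(n, p)) :
  open U -> class_C k U F -> class_C k U G -> class_C k U (fun y => F y *m G y).
Proof.
move=> oU /(class_C_mx _ _ oU) CF /(class_C_mx _ _ oU) CG.
apply/class_C_mx => // i j; under eq_fun do rewrite mxE.
by apply: class_C_sum => // l; apply: class_CM.
Qed.

Lemma class_C_trmx m n k U (F : V -> 'M[R]_(m, n)) :
  open U -> class_C k U F -> class_C k U (fun y => (F y)^T).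
Proof.
move=> oU /(class_C_mx _ _ oU) CF.
by apply/class_C_mx => // i j; under eq_fun do rewrite mxE.
Qed.

Lemma class_C_oppmx m n k U (F : V -> 'M[R]_(m, n)) :
  open U -> class_C k U F -> class_C k U (fun y => - F y).
Proof.
move=> oU /(class_C_mx _ _ oU) CF.
by apply/class_C_mx => // i j; under eq_fun do rewrite mxE; apply: class_CN.
Qed.

(** Cramer's rule: on [U] the entries of the inverse are cofactors divided by a nonvanishing
    determinant. *)
Lemma class_C_invmx n k U (F : V -> 'M[R]_n) : open U ->
  (forall y, U y -> F y \in unitmx) ->
  class_C k U F -> class_C k U (fun y => invmx (F y)).
Proof.
move=> oU uF /(class_C_mx _ _ oU) CF.
have CI i j : class_C k U (fun y => (\det (F y))^-1 * cofactor (F y) j i).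
  apply: class_CM => //.
    apply: class_CV => [//|y Uy|]; last exact: class_C_det.
    by rewrite -unitfE -unitmxE uF.
  rewrite /cofactor; apply: class_CM => //; first exact: class_C_cst.
  apply: class_C_det => // a b; under eq_fun do rewrite !mxE; exact: CF.
apply/class_C_mx => // i j; apply: class_C_near (CI i j) => // y Uy.
by rewrite /invmx uF // !mxE.
Qed.

End ClassC.

(** * Bilinear forms and directional derivatives of matrix fields *)

Section Bilinear.
Context {K : fieldType} {n : nat}.
Implicit Types (B : 'M[K]_n) (u v w : 'cV[K]_n).

Lemma bilE B v w : bil B v w = \sum_i \sum_j v i 0 * w j 0 * B i j.
Proof.
rewrite /bil mxE exchange_big; apply: eq_bigr => j _.
by rewrite mxE mulr_suml; apply: eq_bigr => i _; rewrite mxE mulrAC.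
Qed.

Lemma bilDl B v1 v2 w : bil B (v1 + v2) w = bil B v1 w + bil B v2 w.
Proof. by rewrite /bil linearD /= !mulmxDl mxE. Qed.

Lemma bilNl B v w : bil B (- v) w = - bil B v w.
Proof. by rewrite /bil linearN /= !mulNmx mxE. Qed.

Lemma bilDm B1 B2 v w : bil (B1 + B2) v w = bil B1 v w + bil B2 v w.
Proof. by rewrite /bil mulmxDr mulmxDl mxE. Qed.

Lemma bilNm B v w : bil (- B) v w = - bil B v w.
Proof. by rewrite /bil mulmxN mulNmx mxE. Qed.

Lemma bil_mull B J v w : bil B (J *m v) w = bil (J^T *m B) v w.
Proof. by rewrite /bil trmx_mul !mulmxA. Qed.

Lemma bil_mulr B J v w : bil B v (J *m w) = bil (B *m J) v w.
Proof. by rewrite /bil !mulmxA. Qed.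

Lemma bil_tr B v w : bil B^T v w = bil B w v.
Proof.
rewrite !bilE exchange_big; apply: eq_bigr => j _; apply: eq_bigr => i _.
by rewrite mxE [v _ _ * _]mulrC.
Qed.

Lemma bil_delta B i j : bil B (delta_mx i 0) (delta_mx j 0) = B i j.
Proof. by rewrite /bil trmx_delta -rowE -colE !mxE. Qed.

Lemma mulmx_row_eq0 (v : 'cV[K]_n) B :
  v^T *m B = 0 <-> forall w, bil B v w = 0.
Proof.
split=> [vB w|vB]; first by rewrite /bil vB mul0mx mxE.
apply/rowP => j; have := vB (delta_mx j 0).
by rewrite /bil -colE !mxE.
Qed.

Lemma bil_inj B1 B2 : (forall v w, bil B1 v w = bil B2 v w) -> B1 = B2.
Proof. by move=> BE; apply/matrixP => i j; rewrite -!bil_delta BE. Qed.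

Lemma bil_nondeg B v : B \in unitmx -> (forall w, bil B v w = 0) -> v = 0.
Proof.
move=> uB /mulmx_row_eq0 vB; apply: trmx_inj.
by rewrite -[LHS](mulmxK uB) vB mul0mx trmx0.
Qed.

(* If D l is the l-th partial derivative of a matrix field, along D u is its
   derivative in the direction u. *)
Definition along (D : 'I_n -> 'M[K]_n) (u : 'cV[K]_n) : 'M[K]_n :=
  \sum_l u l 0 *: D l.

Lemma along_delta D l : along D (delta_mx l 0) = D l.
Proof.
rewrite /along (bigD1 l) //= mxE !eqxx scale1r big1 ?addr0 // => i il.
by rewrite mxE (negbTE il) scale0r.
Qed.

(** Turns the index formula into the invariant-looking expression for N(v, w) on coordinate vectors,
    which can then be paired with a form. *)
Lemma nijenhuis_alongE (D : 'I_n -> 'M[K]_n) B (i j k : 'I_n) :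
  let v : 'cV_n := delta_mx i 0 in let w : 'cV_n := delta_mx j 0 in
  \sum_l (B l i * D l k j - B l j * D l k i - B k l * (D i l j - D j l i)) =
  (along D (B *m v) *m w - along D (B *m w) *m v
   - B *m (along D v *m w - along D w *m v)) k 0.
Proof.
have alongE u a b : along D u a b = \sum_l u l 0 * D l a b.
  by rewrite /along summxE; apply: eq_bigr => l _; rewrite mxE.
have colE' (C : 'M[K]_n) a b : (C *m (delta_mx b 0 : 'cV_n)) a 0 = C a b.
  by rewrite -colE mxE.
rewrite /= 2!sumrB [RHS]mxE [X in _ = _ + X]mxE; congr (_ - _).
  rewrite [RHS]mxE [X in _ = _ + X]mxE !colE' !alongE.
  by congr (_ - _); apply: eq_bigr => l _; rewrite colE'.
rewrite [RHS]mxE; apply: eq_bigr => l _; rewrite [X in _ = _ * X]mxE.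
by rewrite [X in _ = _ * (_ + X)]mxE !colE' !along_delta.
Qed.

Lemma bil_along D u v w :
  bil (along D u) v w = \sum_l \sum_i \sum_j u l 0 * v i 0 * w j 0 * D l i j.
Proof.
rewrite bilE exchange_big /=.
under eq_bigr do under eq_bigr do rewrite summxE mulr_sumr.
under eq_bigr do rewrite exchange_big /=.
rewrite exchange_big /=; apply: eq_bigr => l _.
rewrite exchange_big /=; apply: eq_bigr => i _; apply: eq_bigr => j _.
by rewrite mxE !mulrA; congr (_ * _); rewrite mulrC mulrA.
Qed.

Lemma closed_along (D : 'I_n -> 'M[K]_n) :
  (forall i j k, D i j k + D j k i + D k i j = 0) ->
  forall u v w,
    bil (along D u) v w + bil (along D v) w u + bil (along D w) u v = 0.
Proof.
move=> cD u v w; rewrite !bil_along.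
(* Both cyclic terms are reindexed to carry the coefficient [u l 0 * v i 0 * w j 0], so that the
   cyclic identity applies term by term. *)
have -> : \sum_l \sum_i \sum_j v l 0 * w i 0 * u j 0 * D l i j =
          \sum_l \sum_i \sum_j u l 0 * v i 0 * w j 0 * D i j l.
  under eq_bigr do rewrite exchange_big /=.
  rewrite exchange_big /=; apply: eq_bigr => l _; apply: eq_bigr => i _.
  by apply: eq_bigr => j _; congr (_ * _); rewrite mulrC mulrA.
have -> : \sum_l \sum_i \sum_j w l 0 * u i 0 * v j 0 * D l i j =
          \sum_l \sum_i \sum_j u l 0 * v i 0 * w j 0 * D j l i.
  rewrite exchange_big /=; apply: eq_bigr => l _.
  rewrite exchange_big /=; apply: eq_bigr => i _.
  by apply: eq_bigr => j _; congr (_ * _); rewrite -mulrA mulrC.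
rewrite -!big_split big1 //= => l _; rewrite -!big_split big1 //= => i _.
by rewrite -!big_split big1 //= => j _; rewrite -!mulrDr cD mulr0.
Qed.

End Bilinear.

(** * The pointwise identity that makes the Nijenhuis tensor vanish *)

(* da l, db l, df l stand for the l-th partial derivatives, at a point, of the
   components of a, of b(v, w) = a(f v, w) and of an almost complex structure f;
   dfb is the derivative of f^T b = - a. *)
Section NijenhuisAlgebra.
Context {K : realFieldType} {n : nat}.
Variables (a b f : 'M[K]_n) (da db df : 'I_n -> 'M[K]_n).
Hypotheses (fa : b = f^T *m a) (af : b = a *m f) (a_unit : a \in unitmx).
Hypothesis dfa : forall l, db l = (df l)^T *m a + f^T *m da l.
Hypothesis dfb : forall l, (df l)^T *m b + f^T *m db l = - da l.
Hypothesis anti_da : forall l, (da l)^T = - da l.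
Hypothesis anti_db : forall l, (db l)^T = - db l.
Hypothesis closed_da : forall i j k, da i j k + da j k i + da k i j = 0.
Hypothesis closed_db : forall i j k, db i j k + db j k i + db k i j = 0.

Let along_anti (D : 'I_n -> 'M[K]_n) u v w : (forall l, (D l)^T = - D l) ->
  bil (along D u) v w = - bil (along D u) w v :> K.
Proof.
move=> aD; rewrite -bil_tr -bilNm; congr (bil _ _ _).
rewrite /along linear_sum /= -sumrN; apply: eq_bigr => l _.
by rewrite linearZ /= aD scalerN.
Qed.

(** Since [a] is nondegenerate, it suffices that a(N(v, w), z) = 0 for all z. Derivatives of [f] are
    traded for those of [a] and [b]; what remains is linear in the values of [da] and [db]. *)
Lemma nijenhuis_along_eq0 v w :
  along df (f *m v) *m w - along df (f *m w) *m v
  - f *m (along df v *m w - along df w *m v) = 0.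
Proof.
(* The derivative of [b = f^T a], solved for the term containing the derivative of [f]. *)
have dfaE u x y : bil a (along df u *m x) y =
    bil (along db u) x y - bil (along da u) (f *m x) y.
  rewrite !bil_mull -bilNm -bilDm; congr (bil _ _ _).
  rewrite /along linear_sum /= mulmx_suml mulmx_sumr -sumrB.
  apply: eq_bigr => l _.
  by rewrite dfa linearZ /= scalerDr scalemxAl -scalemxAr addrK.
(* The derivative of [f^T b = - a], with the derivative of [f] eliminated through [dfaE]. *)
have dfbE u x y : bil (along db u) x (f *m y) - bil (along da u) (f *m x) (f *m y)
    + bil (along db u) (f *m x) y = - bil (along da u) x y.
  rewrite -dfaE bil_mulr -af !bil_mull -bilNm -bilDm; congr (bil _ _ _).
  rewrite /along linear_sum /= mulmx_suml mulmx_sumr -big_split -sumrN /=.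
  apply: eq_bigr => l _.
  by rewrite linearZ /= -scalemxAl -scalemxAr -scalerDr dfb scalerN.
apply: (bil_nondeg a_unit) => z.
have fE x : bil a (f *m x) z = bil a x (f *m z) by rewrite bil_mull bil_mulr -fa -af.
rewrite !(bilDl, bilNl) fE bilDl bilNl !dfaE.
have := dfbE v w z; have := dfbE w v z; have := dfbE z v w.
(* Closedness of [a] is used at (fv, fw, z) and (v, w, z), that of [b] at (fv, w, z) and (v, fw, z);
   antisymmetry matches the remaining terms. *)
have := closed_along closed_da (f *m v) (f *m w) z.
have := closed_along closed_da v w z.
have := closed_along closed_db (f *m v) w z.
have := closed_along closed_db v (f *m w) z.
have := along_anti (f *m w) z (f *m v) anti_da.
have := along_anti w z v anti_da.
have := along_anti w z (f *m v) anti_db.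
have := along_anti (f *m w) z v anti_db.
lra.
Qed.

End NijenhuisAlgebra.

(** * Components in charts, and integrability from closed forms *)

Section Charts.
Context {R : realType} {n : nat} {M : manifold R n}.
Implicit Types (c : chart R n M) (J B : tensor M).

(** The transition map to [chart_at x] has the reverse transition as a local inverse, so by the
    chain rule their Jacobians are inverse matrices. *)
Lemma frame_unit c y : atlas c -> chart_cod c y -> frame c y \in unitmx.
Proof.
move=> Ac cy; set x := chart_inv c y; set d := chart_at x.
have Ad : atlas d by apply: chart_at_atlas.
have dx : chart_dom d x by apply: chart_at_dom.
have cx : chart_dom c x by apply: chart_inv_dom.
pose f z := chart_map d (chart_inv c z); pose g w := chart_map c (chart_inv d w).
have df : differentiable f y by have [H _] := transition_smooth Ac Ad 1%N; exact: (H y (conj cy dx)).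
have dg : differentiable g (f y).
  have [dg _] := transition_smooth Ad Ac 1%N; apply: dg; split.
    exact: chart_map_cod.
  by rewrite /f -/x chart_mapK.
(* The round trip is the identity only while [chart_inv c z] stays in the domain of [d], which
   continuity ensures near [y]. *)
have gf : \forall z \near y, g (f z) = z.
  have cN : nbhs y (chart_cod c).
    exact: open_nbhs_nbhs (conj (@chart_cod_open _ _ _ c) cy).
  have dN : \forall z \near y, chart_dom d (chart_inv c z).
    apply: (chart_inv_cont cy).
    exact: open_nbhs_nbhs (conj (@chart_dom_open _ _ _ d) dx).
  near=> z; rewrite /f /g chart_mapK; last by near: z.
  by rewrite chart_invK //; near: z.
have JJ : 'J f y *m 'J g (f y) = 1%:M.
  apply/row_matrixP => i; rewrite row_mul !rowE mulmx1.
  rewrite !mul_rV_lin1.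
  transitivity ('D_(delta_mx 0 i) (g \o f) y).
    have dgf : differentiable (g \o f) y by apply: differentiable_comp.
    rewrite (deriveE _ dgf).
    exact: esym (congr1 (fun h => h (delta_mx 0 i)) (diff_comp df dg)).
  by rewrite (near_eq_derive (g := id)) // derive_id.
by rewrite /frame unitmx_tr; exact: (mulmx1_unit JJ).1.
Unshelve. all: by end_near. Qed.

(** [J^T B] is the matrix of the form B(Jv, w), so the frame and its inverse cancel between the two
    factors. *)
Lemma endo_in_tr_form_in c J B y : atlas c -> chart_cod c y ->
  (endo_in c J y)^T *m form_in c B y = form_in c (fun x => (J x)^T *m B x) y.
Proof.
move=> Ac cy; have uF := frame_unit Ac cy.
rewrite /endo_in /form_in !trmx_mul trmx_inv !mulmxA; congr (_ *m _ *m _).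
by apply: mulmxKV; rewrite unitmx_tr.
Qed.

Lemma form_in_unit c B y : atlas c -> chart_cod c y ->
  B (chart_inv c y) \in unitmx -> form_in c B y \in unitmx.
Proof.
by move=> Ac cy uB; rewrite /form_in !unitmx_mul unitmx_tr uB frame_unit.
Qed.

Lemma form_in_tr c B y : (form_in c B y)^T = form_in c (fun x => (B x)^T) y.
Proof. by rewrite /form_in !trmx_mul trmxK mulmxA. Qed.

Lemma form_inN c B y : form_in c (fun x => - B x) y = - form_in c B y.
Proof. by rewrite /form_in mulmxN mulNmx. Qed.

Lemma smooth_formN B : smooth_form B -> smooth_form (fun x => - B x).
Proof.
move=> sB c Ac k; apply: class_C_near (class_C_oppmx (@chart_cod_open _ _ _ c) (sB c Ac k)).
  exact: chart_cod_open.
by move=> y _; rewrite form_inN.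
Qed.

Lemma smooth_endo_tr_form J B : smooth_endo J -> smooth_form B ->
  smooth_form (fun x => (J x)^T *m B x).
Proof.
move=> sJ sB c Ac k; have oc := @chart_cod_open _ _ _ c.
have := class_C_mulmx oc (class_C_trmx oc (sJ c Ac k)) (sB c Ac k).
by apply: class_C_near => // y cy; rewrite endo_in_tr_form_in.
Qed.

Lemma partial_derivable (F : 'rV[R]_n -> 'M[R]_n) y l i j :
  differentiable F y -> derivable (fun z => F z i j) y (delta_mx 0 l).
Proof. by move=> /(@diff_derivable _ _ _ _ _ (delta_mx 0 l)) /derivable_mxP. Qed.

Definition partial_mx (F : 'rV[R]_n -> 'M[R]_n) y l : 'M[R]_n :=
  \matrix_(i, j) partial F l i j y.

Lemma partial_mxE F y l i j : partial_mx F y l i j = partial F l i j y.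
Proof. exact: mxE. Qed.

Lemma partial_mx_mul (F G : 'rV[R]_n -> 'M[R]_n) y l :
  differentiable F y -> differentiable G y ->
  partial_mx (fun z => F z *m G z) y l =
    partial_mx F y l *m G y + F y *m partial_mx G y l.
Proof.
move=> dF dG; apply/matrixP => i j.
rewrite partial_mxE [RHS]mxE [X in _ = X + _]mxE [X in _ = _ + X]mxE.
rewrite -big_split /= /partial.
have -> : (fun z => (F z *m G z) i j) =
          \sum_k (fun z => F z i k) * (fun z => G z k j).
  by apply/funext => z; rewrite mxE fct_sumE.
rewrite derive_sum; last first.
  by move=> k; apply: derivableM; apply: partial_derivable.
apply: eq_bigr => k _; rewrite deriveM; try exact: partial_derivable.
by rewrite !partial_mxE addrC; congr (_ + _); apply: mulrC.
Qed.

Lemma partial_mx_tr (F : 'rV[R]_n -> 'M[R]_n) y l :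
  partial_mx (fun z => (F z)^T) y l = (partial_mx F y l)^T.
Proof.
apply/matrixP => i j; rewrite [RHS]mxE !partial_mxE.
rewrite /partial.
suff -> : (fun z => (F z)^T i j) = (fun z => F z j i) by [].
by apply/funext => z; rewrite mxE.
Qed.

Lemma partial_mxN (F : 'rV[R]_n -> 'M[R]_n) y l : differentiable F y ->
  partial_mx (fun z => - F z) y l = - partial_mx F y l.
Proof.
move=> dF; apply/matrixP => i j; rewrite [RHS]mxE !partial_mxE /partial.
have -> : (fun z => (- F z) i j) = - (fun z => F z i j).
  by apply/funext => z; rewrite mxE.
by rewrite deriveN //; exact: partial_derivable.
Qed.

Lemma partial_mx_near (F G : 'rV[R]_n -> 'M[R]_n) (U : set 'rV[R]_n) y l :
  open U -> U y -> (forall z, U z -> F z = G z) ->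
  partial_mx F y l = partial_mx G y l.
Proof.
move=> oU Uy FG; apply/matrixP => i j; rewrite !partial_mxE; apply: near_eq_derive.
by apply: filterS (open_nbhs_nbhs (conj oU Uy)) => z /FG ->.
Qed.

Lemma nijenhuis_inE c J y k i j : nijenhuis_in c J k i j y =
  let F := endo_in c J y in let DF := along (partial_mx (endo_in c J) y) in
  let v : 'cV_n := delta_mx i 0 in let w : 'cV_n := delta_mx j 0 in
  (DF (F *m v) *m w - DF (F *m w) *m v - F *m (DF v *m w - DF w *m v)) k 0.
Proof.
rewrite /nijenhuis_in; move: (endo_in c J) => F /=.
have <- := nijenhuis_alongE (partial_mx F y) (F y) i j k.
apply: eq_bigr => l _.
by congr (_ * _ - _ * _ - _ * (_ - _)); apply/esym/partial_mxE.
Qed.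

Lemma closed_formN B : smooth_form B -> closed_form B ->
  closed_form (fun x => - B x).
Proof.
move=> sB cB c y Ac cy i j k.
have dB : differentiable (form_in c B) y.
  by have [d _] := sB c Ac 1%N; exact: (d y cy).
have NE a b d : partial (form_in c (fun x => - B x)) a b d y =
    - partial (form_in c B) a b d y.
  transitivity (partial_mx (fun z => - form_in c B z) y a b d).
    rewrite partial_mxE; congr (partial _ a b d y).
    by apply/funext => z; rewrite form_inN.
  by rewrite partial_mxN // [LHS]mxE partial_mxE.
rewrite !NE -!opprD cB //; exact: oppr0.
Qed.

(** In a chart, [J^T a = b] and its consequence [J^T b = - a] hold on an open set, hence may be
    differentiated; with closedness they supply the hypotheses of [nijenhuis_along_eq0]. *)
Lemma complex_structure_of_forms (a b J : tensor M) :
  two_form a -> two_form b -> closed_form a -> closed_form b ->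
  (forall x, a x \in unitmx) -> (forall x, (J x)^T *m a x = b x) ->
  (forall x, J x *m J x = - 1%:M) -> complex_structure J.
Proof.
move=> [sa aT] [sb bT] ca cb ua Ja JJ.
have FA c y : atlas c -> chart_cod c y ->
    (endo_in c J y)^T *m form_in c a y = form_in c b y.
  move=> Ac cy; rewrite endo_in_tr_form_in //.
  by congr (form_in c _ y); apply/funext.
have FB c y : atlas c -> chart_cod c y ->
    (endo_in c J y)^T *m form_in c b y = - form_in c a y.
  move=> Ac cy; rewrite endo_in_tr_form_in // -form_inN.
  congr (form_in c _ y); apply/funext => x.
  by rewrite -Ja mulmxA -trmx_mul JJ linearN /= trmx1 mulNmx mul1mx.
have anti (B : tensor M) c y : (forall x, (B x)^T = - B x) ->
    (form_in c B y)^T = - form_in c B y.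
  move=> BT; rewrite form_in_tr -form_inN; congr (form_in c _ y).
  exact/funext.
have sJ : smooth_endo J.
  move=> c Ac k; have oc := @chart_cod_open _ _ _ c.
  have uA y : chart_cod c y -> form_in c a y \in unitmx.
    by move=> cy; apply: form_in_unit.
  (* Smoothness comes from solving for J in the chart: [J^T = b a^-1]. *)
  have := class_C_trmx oc
    (class_C_mulmx oc (sb c Ac k) (class_C_invmx oc uA (sa c Ac k))).
  by apply: class_C_near => // y cy; rewrite -FA // mulmxK ?trmxK ?uA.
split=> // c y Ac cy k i j.
have oc := @chart_cod_open _ _ _ c.
have dJ : differentiable (endo_in c J) y by have [d _] := sJ c Ac 1%N; exact: (d y cy).
have dJT : differentiable (fun z => (endo_in c J z)^T) y.
  by have [dT _] := class_C_trmx oc (sJ c Ac 1%N); exact: (dT y cy).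
have da : differentiable (form_in c a) y by have [d _] := sa c Ac 1%N; exact: (d y cy).
have db : differentiable (form_in c b) y by have [d _] := sb c Ac 1%N; exact: (d y cy).
rewrite nijenhuis_inE /=.
rewrite (nijenhuis_along_eq0 (a := form_in c a y) (b := form_in c b y)
  (da := partial_mx (form_in c a) y) (db := partial_mx (form_in c b) y)).
- by rewrite mxE.
- by rewrite FA.
- have := congr1 trmx (FA c y Ac cy).
  by rewrite trmx_mul trmxK !anti // mulNmx => /oppr_inj.
- exact: form_in_unit.
- move=> l; rewrite -partial_mx_tr -partial_mx_mul //.
  by apply: (partial_mx_near _ oc cy) => z cz; rewrite FA.
- move=> l; rewrite -partial_mx_tr -partial_mx_mul // -partial_mxN //.
  by apply: (partial_mx_near _ oc cy) => z cz; rewrite FB.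
- move=> l; rewrite -partial_mx_tr -partial_mxN //.
  by congr (partial_mx _ y l); apply/funext => z; apply: anti.
- move=> l; rewrite -partial_mx_tr -partial_mxN //.
  by congr (partial_mx _ y l); apply/funext => z; apply: anti.
- move=> i' j' k'; have <- := ca c y Ac cy i' j' k'.
  by congr (_ + _ + _); apply: partial_mxE.
- move=> i' j' k'; have <- := cb c y Ac cy i' j' k'.
  by congr (_ + _ + _); apply: partial_mxE.
Qed.

End Charts.

(** * Holomorphic symplectic forms at a point and the complex structures they determine *)

Section Pointwise.
Context {R : realType} {n : nat} {M : manifold R n}.
Local Notation C := R[i].
Implicit Types (a b J : tensor M) (Omega : ctensor M) (x : M).

Lemma mulii : 'i%C * 'i%C = -1 :> C.
Proof. by rewrite -expr2 sqr_i. Qed.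

Lemma re_omega_p a b : re_cx (omega_p a b) = a.
Proof.
apply/funext => x; apply/matrixP => i j.
by rewrite !mxE /= !(mul0r, mulr0, mul1r, subr0, addr0).
Qed.

Lemma im_omega_p a b : im_cx (omega_p a b) = b.
Proof.
apply/funext => x; apply/matrixP => i j.
by rewrite !mxE /= !(mul0r, mulr0, mul1r, subr0, addr0, add0r).
Qed.

Lemma conj_omega_p a b : conj_cx (omega_p a b) = omega_m a b.
Proof.
apply/funext => x; apply/matrixP => i j; rewrite !mxE /=.
apply/eqP; rewrite eq_complex /=.
by rewrite !(mul0r, mulr0, mul1r, subr0, addr0, add0r, oppr0) !eqxx.
Qed.

(** At zeta = i the coefficients of w1 + i w2 and w1 - i w2 are -1/2 and 1/2, so w1 cancels. *)
Lemma varpi_i w1 w2 w3 :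
  varpi (omega_p w1 w2) (to_cx w3) (omega_m w1 w2) 'i%C =
  omega_p w3 (fun x => - w2 x) :> ctensor M.
Proof.
apply/funext => x; apply/matrixP => i j; rewrite !mxE rmorphN /=.
have i0 : 'i%C != 0 :> C by rewrite eq_complex /= oner_eq0 andbF.
have -> : 'i%C / (2 * 'i%C) = 2^-1 :> C by rewrite invfM mulrCA divff // mulr1.
have -> : 'i%C / 2 * 'i%C = - 2^-1 :> C by rewrite mulrAC mulii mulN1r.
by field.
Qed.

(** At zeta = -1 both coefficients equal i/2, so w2 cancels. *)
Lemma varpi_N1 w1 w2 w3 :
  varpi (omega_p w1 w2) (to_cx w3) (omega_m w1 w2) (-1) =
  omega_p w3 w1 :> ctensor M.
Proof.
apply/funext => x; apply/matrixP => i j; rewrite !mxE /=.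
by field.
Qed.

Lemma kerf_omega_p a b x v : kerf (omega_p a b) x v <->
  v^T *m to_cx a x = - 'i%C *: (v^T *m to_cx b x).
Proof.
rewrite /kerf /= -mulmx_row_eq0 /omega_p mulmxDr -scalemxAr scaleNr.
by split=> [/eqP|->]; [rewrite addr_eq0 => /eqP|rewrite addNr].
Qed.

Lemma kerf_omega_m a b x v : kerf (omega_m a b) x v <->
  v^T *m to_cx a x = 'i%C *: (v^T *m to_cx b x).
Proof.
rewrite /kerf /= -mulmx_row_eq0 /omega_m mulmxBr -scalemxAr.
by split=> [/eqP|->]; [rewrite subr_eq0 => /eqP|rewrite subrr].
Qed.

Lemma to_cx_inj a b x : to_cx a x = to_cx b x -> a x = b x.
Proof.
move/matrixP => E; apply/matrixP => i j.
by have := E i j; rewrite !mxE => -[].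
Qed.

Lemma mx_eq_on_sum m (E F : set 'cV[C]_n) (A B : 'M[C]_(m, n)) :
  (forall v, exists2 u, E u & F (v - u)) ->
  (forall v, E v -> A *m v = B *m v) -> (forall v, F v -> A *m v = B *m v) ->
  A = B.
Proof.
move=> EF AE AF; apply/trmx_inj/row_matrixP => i; rewrite !rowE.
apply: trmx_inj; rewrite !trmx_mul !trmxK.
have [u Eu Fu] := EF (delta_mx 0 i)^T.
by rewrite -(subrK u (delta_mx 0 i)^T) [LHS]mulmxDr [RHS]mulmxDr (AE u Eu) (AF _ Fu).
Qed.

(** [A = - i B] on one kernel and [A = i B] on the other, so by antisymmetry the two kernels are
    [A]-orthogonal. If [r A = 0] and r = u + u' along the splitting, then [u A = - u' A] vanishes on
    both summands; hence u and u' annihilate [A] and [B], lie in both kernels and are zero. *)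
Lemma omega_p_unit a b x : (a x)^T = - a x -> (b x)^T = - b x ->
  direct_sum (kerf (omega_p a b) x) (kerf (omega_m a b) x) -> a x \in unitmx.
Proof.
move=> aT bT dEF; case: dEF => EF EF0.
set A := to_cx a x; set B := to_cx b x.
have AT : A^T = - A by rewrite /A /to_cx map_trmx aT map_mxN.
have BT : B^T = - B by rewrite /B /to_cx map_trmx bT map_mxN.
have kerA e (v : 'cV[C]_n) : v^T *m A = e *: (v^T *m B) -> A *m v = e *: (B *m v).
  move=> /(congr1 trmx); rewrite linearZ /= !trmx_mul !trmxK AT BT.
  by rewrite !mulNmx scalerN => /oppr_inj.
have both (u : 'cV[C]_n) : u^T *m A = 0 -> u^T *m B = 0 -> u = 0.
  move=> uA uB.
  have : (kerf (omega_p a b) x `&` kerf (omega_m a b) x) u.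
    by split; [apply/kerf_omega_p|apply/kerf_omega_m];
      rewrite -/A -/B uA uB scaler0.
  by rewrite EF0.
rewrite -(map_unitmx (real_complex R)) -/A -row_free_unit.
apply: inj_row_free => r rA.
have [u /kerf_omega_p uA /kerf_omega_m uA'] := EF r^T.
set u' := r^T - u in uA'.
rewrite -/A -/B in uA uA'.
have uu' : u^T *m A = - (u'^T *m A).
  by rewrite /u' linearB /= trmxK mulmxBl rA sub0r opprK.
have uA0 : u^T *m A = 0.
  (* Orthogonality appears as a number equal to its own opposite, depending on which side the kernel
     relation is applied. *)
  have eqN0 (Y : 'cV[C]_1) : Y = - Y -> Y = 0.
    move=> /eqP; rewrite -addr_eq0 -mulr2n -scaler_nat scaler_eq0.
    by rewrite pnatr_eq0 /= => /eqP.
  apply: (mx_eq_on_sum EF) => w; rewrite mul0mx.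
    move=> /kerf_omega_p /kerA Aw; rewrite uu' mulNmx.
    rewrite (eqN0 (u'^T *m A *m w)) ?oppr0 // {2}uA' -mulmxA Aw.
    by rewrite -scalemxAr scaleNr -scalemxAl mulmxA.
  move=> /kerf_omega_m /kerA Aw; apply: eqN0.
  by rewrite {2}uA -mulmxA Aw -scalemxAr scaleNr mulNmx opprK -scalemxAl mulmxA.
have i0 : 'i%C != 0 :> C by rewrite eq_complex /= oner_eq0 andbF.
have u'A0 : u'^T *m A = 0 by rewrite -[LHS]opprK -uu' uA0 oppr0.
have uB0 : u^T *m B = 0.
  by move/eqP: uA; rewrite uA0 eq_sym scaler_eq0 oppr_eq0 (negbTE i0) => /eqP.
have u'B0 : u'^T *m B = 0.
  by move/eqP: uA'; rewrite u'A0 eq_sym scaler_eq0 (negbTE i0) => /eqP.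
apply: trmx_inj; rewrite trmx0 -(subrK u r^T) -/u'.
by rewrite (both u) // (both u') // addr0.
Qed.

(** Transposing the eigenvector equation and multiplying by [A] gives - v^T B = e v^T A, and e^2 =
    -1 moves the scalar across. The values e = -i and e = i cover [T01] and [T10]. *)
Lemma eigen_kerf a b J x (e : C) (v : 'cV[C]_n) : e * e = -1 -> a x \in unitmx ->
  (J x)^T *m a x = - b x ->
  to_cx J x *m v = e *: v <-> v^T *m to_cx a x = e *: (v^T *m to_cx b x).
Proof.
move=> ee ua Ja; set A := to_cx a x; set B := to_cx b x.
have uA : A \in unitmx by rewrite map_unitmx.
have JA : (to_cx J x)^T *m A = - B.
  by rewrite /to_cx map_trmx -map_mxM Ja map_mxN.
have eK m (X : 'M[C]_(m, n)) : e *: (e *: X) = - X by rewrite scalerA ee scaleN1r.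
split=> [/(congr1 trmx)|vA].
  rewrite trmx_mul linearZ /= => /(congr1 (mulmx^~ A)).
  rewrite -mulmxA JA mulmxN -scalemxAl => /(congr1 ( *:%R e)).
  by rewrite eK scalerN => /oppr_inj.
apply: trmx_inj; rewrite trmx_mul linearZ /=.
apply: (can_inj (mulmxK uA)).
by rewrite -mulmxA JA mulmxN -scalemxAl vA eK.
Qed.

Lemma mulNiNi : (- 'i%C) * (- 'i%C) = -1 :> C.
Proof. by rewrite mulrNN mulii. Qed.

Lemma T01_kerf a b J x : a x \in unitmx -> (J x)^T *m a x = - b x ->
  T01 J x = kerf (omega_p a b) x.
Proof.
move=> ua Ja; apply/seteqP; split=> v.
  by move=> /(eigen_kerf v mulNiNi ua Ja) /kerf_omega_p.
by move=> /kerf_omega_p /(eigen_kerf v mulNiNi ua Ja).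
Qed.

Lemma T10_kerf a b J x : a x \in unitmx -> (J x)^T *m a x = - b x ->
  T10 J x = kerf (omega_m a b) x.
Proof.
move=> ua Ja; apply/seteqP; split=> v.
  by move=> /(eigen_kerf v mulii ua Ja) /kerf_omega_m.
by move=> /kerf_omega_m /(eigen_kerf v mulii ua Ja).
Qed.

Lemma T01_T10_span J x : J x *m J x = - 1%:M ->
  forall v, exists2 u, T01 J x u & T10 J x (v - u).
Proof.
move=> JJ v; set Jc := to_cx J x.
have JcJc w : Jc *m (Jc *m w) = - w.
  by rewrite mulmxA /Jc /to_cx -map_mxM JJ map_mxN map_mx1 mulNmx mul1mx.
(* The projections onto the eigenspaces of -i and i are (1 + iJ)/2 and (1 - iJ)/2. *)
exists (2^-1 *: (v + 'i%C *: (Jc *m v))).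
  rewrite /T01 /= -/Jc -scalemxAr mulmxDr -scalemxAr JcJc scalerA mulrC -scalerA.
  congr (_ *: _); rewrite scalerDr scalerA mulNr mulii opprK scale1r scaleNr.
  by rewrite scalerN addrC.
have -> : v - 2^-1 *: (v + 'i%C *: (Jc *m v)) = 2^-1 *: (v - 'i%C *: (Jc *m v)).
  rewrite scalerDr scalerBr opprD addrA; congr (_ - _).
  rewrite -{1}[v]scale1r -scalerBl; congr (_ *: _).
  by field.
rewrite /T10 /= -/Jc -scalemxAr mulmxBr -scalemxAr JcJc scalerA mulrC -scalerA.
congr (_ *: _); rewrite scalerBr scalerA mulii scaleN1r opprK.
by rewrite scalerN opprK addrC.
Qed.

Lemma complex_structure_eq J J' x : J x *m J x = - 1%:M ->
  T01 J' x = T01 J x -> T10 J' x = T10 J x -> J' x = J x.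
Proof.
move=> JJ E01 E10; apply: to_cx_inj; apply: (mx_eq_on_sum (T01_T10_span JJ)).
  by move=> v Jv; have := Jv; rewrite -E01 /T01 /= => ->; rewrite Jv.
by move=> v Jv; have := Jv; rewrite -E10 /T10 /= => ->; rewrite Jv.
Qed.

(** [cs_of] is a choice with a default value. [J] satisfies its defining property, and a complex
    structure is determined by its two eigenbundles, so the choice is [J]. *)
Lemma cs_of_omega_p a b J : complex_structure J ->
  (forall x, a x \in unitmx) -> (forall x, (J x)^T *m a x = - b x) ->
  cs_of (omega_p a b) = J.
Proof.
move=> cJ ua Ja; apply: xget_unique => [|J' [cJ' kJ']].
  split=> // x; rewrite conj_omega_p; split; [exact: T01_kerf|exact: T10_kerf].
apply/funext => x; have [_ JJ _] := cJ; have [J'01 J'10] := kJ' x.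
apply: complex_structure_eq => //.
  by rewrite J'01 (T01_kerf (ua x) (Ja x)).
by rewrite J'10 conj_omega_p (T10_kerf (ua x) (Ja x)).
Qed.

Lemma hol_symplectic_cs_of a b : hol_symplectic (omega_p a b) ->
  [/\ symplectic_form a, two_form b /\ closed_form b,
      complex_structure (cs_of (omega_p a b)) &
      forall x, (cs_of (omega_p a b) x)^T *m a x = - b x].
Proof.
rewrite /hol_symplectic re_omega_p im_omega_p conj_omega_p.
move=> [[ta tb] [ca cb] dab].
have [_ aT] := ta; have [sb bT] := tb.
have ua x : a x \in unitmx by exact: omega_p_unit (aT x) (bT x) (dab x).
have [J Ja] : exists J : tensor M, forall x, (J x)^T *m a x = - b x.
  exists (fun x => - (b x *m invmx (a x))^T) => x.
  by rewrite linearN /= trmxK mulNmx mulmxKV.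
(* Checked over the complex numbers on the two kernels, which span and on which J acts by -i and
   i. *)
have JJ x : J x *m J x = - 1%:M.
  apply: (@to_cx_inj (fun x => J x *m J x) (fun=> - 1%:M)).
  have [span _] := dab x.
  rewrite /to_cx map_mxM map_mxN map_mx1 -/(to_cx J x).
  apply: (mx_eq_on_sum span) => v.
    rewrite -(T01_kerf (ua x) (Ja x)) /T01 /= => Jv.
    by rewrite -mulmxA Jv -scalemxAr Jv scalerA mulNiNi mulNmx mul1mx scaleN1r.
  rewrite -(T10_kerf (ua x) (Ja x)) /T10 /= => Jv.
  by rewrite -mulmxA Jv -scalemxAr Jv scalerA mulii mulNmx mul1mx scaleN1r.
(* [complex_structure_of_forms] expects [J^T a = b], so it is applied to [a] and [- b]. *)
have tNb : two_form (fun x => - b x).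
  by split=> [|x]; [exact: smooth_formN|rewrite linearN /= bT].
have cNb : closed_form (fun x => - b x).
  exact: closed_formN.
have cJ : complex_structure J.
  exact: complex_structure_of_forms ta tNb ca cNb ua Ja JJ.
by rewrite (cs_of_omega_p cJ ua Ja); split.
Qed.

End Pointwise.

(** * Quaternion relations and triples *)

Section Quaternions.
Context {R : realType} {n : nat}.

(** Associativity alone yields the other products: the three squares and I J = K present the
    quaternion relations. *)
Lemma quaternion_relations (I J K : 'M[R]_n) :
  I *m I = - 1%:M -> J *m J = - 1%:M -> K *m K = - 1%:M -> I *m J = K ->
  [/\ J *m K = I, K *m I = J, J *m I = - K, K *m J = - I & I *m K = - J].
Proof.
move=> II JJ KK IJ.
have KJ : K *m J = - I by rewrite -IJ -mulmxA JJ mulmxN mulmx1.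
have IK : I *m K = - J by rewrite -IJ mulmxA II mulNmx mul1mx.
have JK : J *m K = I.
  have : I *m (J *m K) = - 1%:M by rewrite mulmxA IJ KK.
  move=> /(congr1 (mulmx I)).
  by rewrite mulmxA II !mulmxN mulNmx mul1mx mulmx1 => /oppr_inj.
have JI : J *m I = - K by rewrite -JK mulmxA JJ mulNmx mul1mx.
by split=> //; rewrite -JK mulmxA KJ mulNmx IK opprK.
Qed.

Ltac expand_eps :=
  rewrite !big_ord_recl big_ord0 /triple !(tnth_nth (fun=> 0));
  rewrite /eps /= /bump /= ?addn0.

Lemma quaternionic_triple {M : manifold R n} (I J K : tensor M) :
  quaternionic (triple I J K) <->
  forall x, [/\ I x *m I x = - 1%:M, J x *m J x = - 1%:M,
                K x *m K x = - 1%:M & I x *m J x = K x].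
Proof.
split=> [Q x|Q].
  pose o0 : 'I_3 := @Ordinal 3 0 isT; pose o1 : 'I_3 := @Ordinal 3 1 isT.
  pose o2 : 'I_3 := @Ordinal 3 2 isT.
  split; [have := Q o0 o0 x|have := Q o1 o1 x|have := Q o2 o2 x|have := Q o0 o1 x];
  expand_eps => ->; apply/matrixP => i j; rewrite !mxE ?mul0rn; by field.
move=> a b x; have [II JJ KK IJ] := Q x.
have [JK KI JI KJ IK] := quaternion_relations II JJ KK IJ.
case: a => [[|[|[|k]]] ia] //; case: b => [[|[|[|k]]] ib] //; expand_eps;
  rewrite ?(II, JJ, KK, IJ, JK, KI, JI, KJ, IK);
  apply/matrixP => i j; rewrite !mxE ?mul0rn; by field.
Qed.

Lemma triple_eta T (f : 'I_3 -> T) : f =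
  triple (f (@Ordinal 3 0 isT)) (f (@Ordinal 3 1 isT)) (f (@Ordinal 3 2 isT)).
Proof.
apply/funext => -[[|[|[|k]]] ia] //; rewrite /triple (tnth_nth (f ord0)) /=;
  by congr f; apply: val_inj.
Qed.

Lemma triple_forall T (P : 'I_3 -> T -> Prop) (a b c : T) :
  (forall i, P i (triple a b c i)) <->
  [/\ P (@Ordinal 3 0 isT) a, P (@Ordinal 3 1 isT) b & P (@Ordinal 3 2 isT) c].
Proof.
have E k (H : (k < 3)%N) : triple a b c (Ordinal H) = nth a [:: a; b; c] k.
  by rewrite /triple (tnth_nth a).
split=> [H|[Pa Pb Pc] [[|[|[|k]]] i]] //.
- by rewrite E /= (bool_irrelevance i isT).
- by rewrite E /= (bool_irrelevance i isT).
- by rewrite E /= (bool_irrelevance i isT).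
Qed.

End Quaternions.

(** * The three statements on twistor families *)

Section Twistor.
Context {R : realType} {n : nat} {M : manifold R n}.
Local Notation C := R[i].

(** On the unit circle the antipode is [- z], which is what pairs v + z K v with v - z K v. *)
Lemma antipode_J1 : antipode (Some 'i%C) = Some (- 'i%C) :> P1 R.
Proof.
have i0 : 'i%C != 0 :> C by rewrite eq_complex /= oner_eq0 andbF.
have ci : conjc 'i%C = - 'i%C :> C by apply/eqP; rewrite eq_complex /= oppr0 !eqxx.
rewrite /antipode (negbTE i0) ci; congr (Some (- _)).
by apply: (mulfI i0); rewrite invrN mulrN divff // mulii.
Qed.

Lemma antipode_J2 : antipode (Some (-1)) = Some (- -1) :> P1 R.
Proof.
have N0 : -1 != 0 :> C by rewrite oppr_eq0 oner_eq0.
have cN : conjc (-1) = -1 :> C by rewrite rmorphN rmorph1.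
by rewrite /antipode (negbTE N0) cN invrN invr1.
Qed.

(** The sum and the difference of the two equations isolate 2 A v and 2 A k. *)
Lemma opposite_eigenvectors (A : 'M[C]_n) (v k : 'cV[C]_n) :
  A *m (v + k) = - 'i%C *: (v + k) -> A *m (v - k) = 'i%C *: (v - k) ->
  A *m v = - 'i%C *: k /\ A *m k = - 'i%C *: v.
Proof.
rewrite mulmxDr mulmxBr; move: (A *m v) (A *m k) => p q Ep Em.
have E2 : p + p = (p + q) + (p - q) by rewrite addrACA subrr addr0.
have E2' : q + q = (p + q) - (p - q) by rewrite opprB [q - p]addrC addrACA subrr add0r.
split; apply/colP => j.
  move/colP: E2 => /(_ j); rewrite Ep Em !mxE => E.
  by apply: (@mulfI _ 2); rewrite ?pnatr_eq0 // mulr2n mulrDl mul1r E; ring.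
move/colP: E2' => /(_ j); rewrite Ep Em !mxE => E.
by apply: (@mulfI _ 2); rewrite ?pnatr_eq0 // mulr2n mulrDl mul1r E; ring.
Qed.

Lemma twistor_family_quaternionic (J : P1 R -> tensor M) (K : ctensor M) :
  (forall z, complex_structure (J z)) ->
  (forall z x, J (antipode z) x = - J z x) ->
  bundle_iso (T01 (J (Some 0))) (T10 (J (Some 0))) K ->
  (forall (z : C) x, T01 (J (Some z)) x
     = [set v + z *: (K x *m v) | v in T01 (J (Some 0)) x]) ->
  (forall x v, T01 (J (Some 0)) x v ->
     K x *m v = to_cx (J (Some 'i%C)) x *m v) /\
  quaternionic (J123 J).
Proof.
move=> cJ JN [_ _ bK] JT.
have act z x v : antipode (Some z) = Some (- z) -> T01 (J (Some 0)) x v ->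
    let A := to_cx (J (Some z)) x in
    A *m v = - 'i%C *: (z *: (K x *m v)) /\
    A *m (z *: (K x *m v)) = - 'i%C *: v.
  move=> az Tv A.
  have TJ z' : T01 (J (Some z')) x (v + z' *: (K x *m v)) by rewrite JT; exists v.
  apply: opposite_eigenvectors; first exact: TJ z.
  (* v - z K v is a -i eigenvector of J(-z) = - J(z), hence an i eigenvector of J(z). *)
  have := TJ (- z); rewrite -az /T01 /to_cx JN map_mxN /= mulNmx.
  rewrite -/(to_cx _ x) -/A.
  by rewrite !scaleNr => /oppr_inj.
have act1 x v : T01 (J (Some 0)) x v ->
    to_cx (J (Some 'i%C)) x *m v = K x *m v /\
    to_cx (J (Some 'i%C)) x *m (K x *m v) = - v.
  move=> Tv; have [-> Ek] := act _ x v antipode_J1 Tv; split.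
    by rewrite scalerA mulNr mulii opprK scale1r.
  move: Ek => /(congr1 ( *:%R 'i%C)).
  by rewrite -scalemxAr !scalerA mulrN mulii opprK scaleN1r scale1r => vE;
    rewrite -[LHS]opprK vE.
have act2 x v : T01 (J (Some 0)) x v ->
    to_cx (J (Some (-1))) x *m v = 'i%C *: (K x *m v) /\
    to_cx (J (Some (-1))) x *m (K x *m v) = 'i%C *: v.
  move=> Tv; have [-> Ek] := act _ x v antipode_J2 Tv; split.
    by rewrite scaleN1r scalerN scaleNr opprK.
  by move: Ek; rewrite scaleN1r mulmxN scaleNr => /oppr_inj.
split=> [x v /act1 [] //|].
apply/quaternionic_triple => x.
have JJ z : J z x *m J z x = - 1%:M by case: (cJ z).
split=> //; apply: (@to_cx_inj _ _ _ (fun x => _ *m _)).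
have [_ _ Ksurj] := bK x.
(* J1 J2 = J3 is compared on the eigenspaces of J3. On [T01], J1 J2 v = J1 (i K v) = - i v. *)
rewrite /to_cx map_mxM; apply: (mx_eq_on_sum (T01_T10_span (JJ (Some 0)))).
  move=> v Tv; rewrite -mulmxA (act2 x v Tv).1 -scalemxAr (act1 x v Tv).2.
  by rewrite scalerN -scaleNr; apply/esym.
(* On [T10], surjectivity of K gives w = K v, and J1 J2 w = J1 (i v) = i w. *)
move=> w Tw; have [v Tv vw] := Ksurj w Tw.
rewrite -mulmxA -{1}vw (act2 x v Tv).2 -scalemxAr (act1 x v Tv).1 vw.
exact/esym.
Qed.

Lemma hyper_kahler_forms (w1 w2 w3 : tensor M) :
  hol_symplectic (omega_p w1 w2) ->
  (forall z : C, z != 0 ->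
     hol_symplectic (varpi (omega_p w1 w2) (to_cx w3) (omega_m w1 w2) z)) ->
  exists g : tensor M, pseudo_hyper_kahler g (triple w1 w2 w3)
    (J123 (varpi_cs (omega_p w1 w2) (to_cx w3) (omega_m w1 w2))).
Proof.
move=> h0 hz.
have i0 : 'i%C != 0 :> C by rewrite eq_complex /= oner_eq0 andbF.
have N0 : -1 != 0 :> C by rewrite oppr_eq0 oner_eq0.
have := hz _ i0; have := hz _ N0; rewrite varpi_i varpi_N1 => h2 h1 {hz}.
rewrite /J123 /varpi_cs eqxx (negbTE i0) (negbTE N0) varpi_i varpi_N1.
have [s1 [t2 c2] cJ3 J3w1] := hol_symplectic_cs_of h0.
have [s3 _ cJ1 J1w3] := hol_symplectic_cs_of h1.
have [_ _ cJ2 J2w3] := hol_symplectic_cs_of h2.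
move: (cs_of (omega_p w3 (fun x => - w2 x))) cJ1 J1w3.
move: (cs_of (omega_p w3 w1)) cJ2 J2w3.
move: (cs_of (omega_p w1 w2)) cJ3 J3w1.
move=> J3 cJ3 J3w1 J2 cJ2 J2w3 J1 cJ1 J1w3.
have [t1 c1 u1] := s1; have [t3 c3 u3] := s3.
have [_ w1T] := t1; have [_ w2T] := t2; have [sw3 w3T] := t3.
have [_ JJ1 _] := cJ1; have [_ JJ2 _] := cJ2; have [sJ3 JJ3 _] := cJ3.
have sq (J w w' : 'M[R]_n) : J *m J = - 1%:M -> J^T *m w = w' -> J^T *m w' = - w.
  by move=> JJ <-; rewrite mulmxA -trmx_mul JJ linearN /= trmx1 mulNmx mul1mx.
have {}J1w3 x : (J1 x)^T *m w3 x = w2 x by rewrite J1w3 opprK.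
have J3w2 x : (J3 x)^T *m w2 x = w1 x.
  by rewrite -[w2 x]opprK mulmxN (sq _ _ _ (JJ3 x) (J3w1 x)) opprK.
have J2w1 x : (J2 x)^T *m w1 x = w3 x.
  by rewrite -[w1 x]opprK mulmxN (sq _ _ _ (JJ2 x) (J2w3 x)) opprK.
have J12 x : J1 x *m J2 x = J3 x.
  (* (J2 J1)^T w1 = J1^T w3 = w2 = - J3^T w1, and w1 is nondegenerate. *)
  have J21 : J2 x *m J1 x = - J3 x.
    apply: trmx_inj; rewrite trmx_mul linearN /=; apply: (can_inj (mulmxK (u1 x))).
    by rewrite -mulmxA J2w1 J1w3 mulNmx J3w1 opprK.
  have : J3 x *m (J1 x *m J2 x) = - 1%:M.
    rewrite -[J3 x]opprK -J21 mulNmx -mulmxA [J1 x *m (_ *m _)]mulmxA JJ1.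
    by rewrite mulNmx mul1mx mulmxN JJ2 !opprK.
  move=> /(congr1 (mulmx (J3 x))).
  by rewrite mulmxA JJ3 mulNmx mul1mx mulmxN mulmx1 => /oppr_inj.
have Q x := quaternion_relations (JJ1 x) (JJ2 x) (JJ3 x) (J12 x).
(* The only solution of w3 = J3^T g; the quaternion relations give w1 and w2 the same form. *)
pose g : tensor M := fun x => - ((J3 x)^T *m w3 x).
have g3 x : w3 x = (J3 x)^T *m g x.
  by rewrite /g mulmxN (sq _ _ _ (JJ3 x) erefl) opprK.
have g2 x : w2 x = (J2 x)^T *m g x.
  have [_ _ _ KJ _] := Q x.
  by rewrite /g mulmxN mulmxA -trmx_mul KJ linearN /= mulNmx opprK J1w3.
have g1 x : w1 x = (J1 x)^T *m g x.
  have [_ KI _ _ _] := Q x.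
  by rewrite /g mulmxN mulmxA -trmx_mul KI J2w3 opprK.
have u2 x : w2 x \in unitmx.
  rewrite -J1w3 unitmx_mul u3 andbT unitmx_tr.
  have : J1 x *m (- J1 x) = 1%:M by rewrite mulmxN JJ1 opprK.
  by move=> /mulmx1_unit [].
(* The transpose of g is w3 J3 = w3 J1 J2 = w2 J2 = - J3^T w1 J2 = - J3^T w3. *)
have gT x : (g x)^T = g x.
  have w3J1 : w3 x *m J1 x = w2 x.
    by rewrite -[LHS]trmxK trmx_mul w3T mulmxN J1w3 linearN /= w2T opprK.
  have w1J2 : w1 x *m J2 x = w3 x.
    by rewrite -[LHS]trmxK trmx_mul w1T mulmxN J2w1 linearN /= w3T opprK.
  have w3J3 : w3 x *m J3 x = w2 x *m J2 x by rewrite -J12 mulmxA w3J1.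
  rewrite /g linearN /= trmx_mul trmxK w3T mulNmx opprK w3J3.
  by rewrite -[w2 x]opprK -J3w1 mulNmx -mulmxA w1J2.
exists g; split.
- split=> //.
    exact/smooth_formN/smooth_endo_tr_form.
  move=> x; have := u3 x; rewrite g3 unitmx_mul => /andP[_ //].
- by case=> [[|[|[|k]]] i].
- by case=> [[|[|[|k]]] i].
- by apply/quaternionic_triple.
- case=> [[|[|[|k]]] i] // x v1 v2; rewrite /triple !(tnth_nth (fun=> 0)) /= bil_mull;
    by rewrite -?g1 -?g2 -?g3.
Qed.

(** Compatibility reads w_a = J_a^T g. Eliminating g by the quaternion relations gives J1^T w3 = w2,
    J2^T w3 = - w1 and J3^T w1 = - w2, which characterize the structures chosen by [cs_of]. *)
Lemma hyper_kahler_forms_unique (g0 w1 w2 w3 : tensor M) (J0 : 'I_3 -> tensor M) :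
  pseudo_hyper_kahler g0 (triple w1 w2 w3) J0 ->
  let J := J123 (varpi_cs (omega_p w1 w2) (to_cx w3) (omega_m w1 w2)) in
  (forall a, J a = J0 a) /\
  (forall g : tensor M, pseudo_hyper_kahler g (triple w1 w2 w3) J -> g = g0).
Proof.
have i0 : 'i%C != 0 :> C by rewrite eq_complex /= oner_eq0 andbF.
have N0 : -1 != 0 :> C by rewrite oppr_eq0 oner_eq0.
move=> H0; rewrite /J123 /varpi_cs eqxx (negbTE i0) (negbTE N0) varpi_i varpi_N1 /=.
have wg g J a x : pseudo_hyper_kahler g (triple w1 w2 w3) J ->
    triple w1 w2 w3 a x = (J a x)^T *m g x.
  move=> [_ _ _ _ wgJ]; apply: bil_inj => v1 v2.
  by rewrite wgJ bil_mull.
have J0E : forall a, triple (cs_of (omega_p w3 (fun x => - w2 x)))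
    (cs_of (omega_p w3 w1)) (cs_of (omega_p w1 w2)) a = J0 a.
  have [_ sw cJ qJ _] := H0.
  pose o0 : 'I_3 := @Ordinal 3 0 isT; pose o1 : 'I_3 := @Ordinal 3 1 isT.
  pose o2 : 'I_3 := @Ordinal 3 2 isT.
  have [_ _ u1] : symplectic_form w1 := sw o0.
  have [_ _ u3] : symplectic_form w3 := sw o2.
  have g1 x : w1 x = (J0 o0 x)^T *m g0 x := wg _ _ o0 x H0.
  have g2 x : w2 x = (J0 o1 x)^T *m g0 x := wg _ _ o1 x H0.
  have g3 x : w3 x = (J0 o2 x)^T *m g0 x := wg _ _ o2 x H0.
  move: qJ; rewrite (triple_eta J0) => /quaternionic_triple qJ.
  have Q x := let: And4 II JJ KK IJ := qJ x in quaternion_relations II JJ KK IJ.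
  apply/(triple_forall (fun a J => J = triple (J0 o0) (J0 o1) (J0 o2) a)); split.
  - apply: cs_of_omega_p => [|//|x]; first exact: cJ.
    have [_ KI _ _ _] := Q x.
    by rewrite opprK g3 mulmxA -trmx_mul KI g2.
  - apply: cs_of_omega_p => [|//|x]; first exact: cJ.
    have [_ _ _ KJ _] := Q x.
    by rewrite g3 mulmxA -trmx_mul KJ linearN /= mulNmx g1.
  - apply: cs_of_omega_p => [|//|x]; first exact: cJ.
    have [_ _ _ _ IK] := Q x.
    by rewrite g1 mulmxA -trmx_mul IK linearN /= mulNmx g2.
split=> // g H; apply/funext => x.
have JJ : J0 ord0 x *m J0 ord0 x = - 1%:M by have [_ _ cJ _ _] := H0; case: (cJ ord0).
have uJ : (J0 ord0 x)^T \in unitmx.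
  have : J0 ord0 x *m (- J0 ord0 x) = 1%:M by rewrite mulmxN JJ opprK.
  by rewrite unitmx_tr => /mulmx1_unit [].
(* Both metrics solve w1 = J1^T g with the same invertible J1. *)
apply: (can_inj (mulKmx uJ)).
by rewrite -(wg _ _ ord0 x H0) (wg _ _ ord0 x H) J0E.
Qed.

End Twistor.

Theorem mainTheorem1 (R : realType) (n : nat) (M : manifold R n) :
  (* (a) *)
  (forall (J : P1 R -> tensor M) (K : ctensor M),
     (forall z, complex_structure (J z)) ->
     (forall z x, J (antipode z) x = - J z x) ->
     bundle_iso (T01 (J (Some 0))) (T10 (J (Some 0))) K ->
     (forall (z : R[i]) x,
        T01 (J (Some z)) x
        = [set v + z *: (K x *m v) | v in T01 (J (Some 0)) x]) ->
     (forall x v, T01 (J (Some 0)) x v ->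
        K x *m v = to_cx (J (Some 'i%C)) x *m v) /\
     quaternionic (J123 J)) /\
  (* (b) *)
  (forall (op o3 om : ctensor M) (w1 w2 w3 : tensor M),
     hol_symplectic op ->
     om = conj_cx op ->
     o3 = conj_cx o3 ->
     (forall z : R[i], z != 0 -> hol_symplectic (varpi op o3 om z)) ->
     op = omega_p w1 w2 ->
     om = omega_m w1 w2 ->
     o3 = to_cx w3 ->
     exists g : tensor M,
       pseudo_hyper_kahler g (triple w1 w2 w3) (J123 (varpi_cs op o3 om))) /\
  (* (c) *)
  (forall (g0 : tensor M) (w1 w2 w3 : tensor M) (J0 : 'I_3 -> tensor M),
     pseudo_hyper_kahler g0 (triple w1 w2 w3) J0 ->
     let J := J123 (varpi_cs (omega_p w1 w2) (to_cx w3) (omega_m w1 w2)) in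
     (forall a, J a = J0 a) /\
     (forall g : tensor M,
        pseudo_hyper_kahler g (triple w1 w2 w3) J -> g = g0)).
Proof.
split; first exact: twistor_family_quaternionic.
split; last exact: hyper_kahler_forms_unique.
move=> op o3 om w1 w2 w3 h0 _ _ hz opE omE o3E; move: h0 hz.
rewrite opE omE o3E; exact: hyper_kahler_forms.
Qed.
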